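(* The following assertions hold. (i) Let $k$ be a positive integer and let $D$ be a digraph of order $n = 2k$. If $\delta^{0}(D) \geq \lceil (n+k)/2 \rceil - 1$, then $D$ is unpaired many-to-many $k$-coverable. Moreover, the bound for $\delta^{0}(D)$ is sharp, in the following sense: for every $k \geq 2$ and $n=2k$ there exists a digraph $D$ on $n$ vertices with $\delta^{0}(D) = \lceil (n+k)/2 \rceil - 2$ which is not unpaired many-to-many $k$-coverable. (ii) For every integer $m \geq 2$, the complete bipartite digraph $\overleftrightarrow{K}_{m,m}$ is unpaired many-to-many $m$-coverable, but it is not unpaired many-to-many $k$-coverable for any integer $k$ with $1 \leq k < m$.
   Context: All digraphs $D=(V(D),A(D))$ are finite, with no parallel arcs and no loops (pairs of oppositely directed arcs are allowed). The order of $D$ is $|V(D)|$. A path always means a directed path; an $x$-$y$ path is a path from $x$ to $y$. The minimum semi-degree $\delta^{0}(D)$ is the minimum, over all vertices $v$ of $D$, of the out-degrees $d^{+}_D(v)$ and in-degrees $d^{-}_D(v)$. The complete bipartite digraph $\overleftrightarrow{K}_{a,b}$ is obtained from the complete bipartite graph $K_{a,b}$ by replacing each edge with two arcs of opposite directions. Let $S=\{s_1,\dots,s_k\}$ (source set) and $T=\{t_1,\dots,t_k\}$ (sink set) be two disjoint $k$-element subsets of $V(D)$. An unpaired many-to-many $k$-DDPC ($k$-disjoint directed path cover) for $S$ and $T$ is a set of $k$ pairwise vertex-disjoint paths $\{P_1,\dots,P_k\}$ of $D$ with $\bigcup_{i=1}^{k} V(P_i)=V(D)$ such that, for some permutation $\sigma$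 of $\{1,\dots,k\}$, $P_i$ is an $s_i$-$t_{\sigma(i)}$ path for each $i$. A digraph $D$ of order $n\geq 2k$ is unpaired many-to-many $k$-coverable if it has an unpaired many-to-many $k$-DDPC for every pair of disjoint source set $S=\{s_1,\dots,s_k\}$ and sink set $T=\{t_1,\dots,t_k\}$. *)

(* Defs.v *)
From mathcomp Require Import all_boot all_fingroup.

Set Implicit Arguments.
Unset Strict Implicit.
Unset Printing Implicit Defensive.

(* Arcs form a binary relation, so parallel arcs cannot occur, while pairs of
   oppositely directed arcs are allowed. *)
Record digraph := Digraph {
  vertex :> finType;
  darc : rel vertex;
  darc_irr : irreflexive darc }.

Section Digraph.
Variable D : digraph.

Definition outdeg (v : D) : nat := #|[set w | darc v w]|.
Definition indeg (v : D) : nat := #|[set w | darc w v]|.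

(* The default value #|D| exceeds every degree, so for a nonempty digraph this
   is the minimum of all in- and out-degrees. *)
Definition min_semidegree : nat :=
  \big[minn/#|D|]_(v : D) minn (outdeg v) (indeg v).

(* A path is given by the sequence of all its vertices, both ends included. *)
Definition dipath (x y : D) (p : seq D) : bool :=
  if p is z :: q then [&& z == x, path (@darc D) z q, last z q == y & uniq p]
  else false.

Definition unpaired_DDPC (k : nat) (s t : 'I_k -> D) (P : 'I_k -> seq D) : Prop :=
  [/\ forall i j : 'I_k, i != j -> [disjoint P i & P j],
      forall v : D, exists i : 'I_k, v \in P i
    & exists sigma : {perm 'I_k}, forall i : 'I_k, dipath (s i) (t (sigma i)) (P i)].

(* The sets S and T are given by injective labellings s and t. The condition on
   the order belongs to the notion: without it, small digraphs would be
   coverable vacuously. *)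
Definition unpaired_coverable (k : nat) : Prop :=
  2 * k <= #|D| /\
  forall s t : 'I_k -> D, injective s -> injective t ->
    (forall i j : 'I_k, s i != t j) ->
    exists P : 'I_k -> seq D, unpaired_DDPC s t P.

End Digraph.

Section CompleteBipartite.
Variables a b : nat.

Definition Kab_arc : rel ('I_a + 'I_b)%type :=
  fun u v => match u, v with
             | inl _, inr _ | inr _, inl _ => true
             | _, _ => false
             end.

Lemma Kab_arc_irr : irreflexive Kab_arc.
Proof. by case. Qed.

Definition complete_bipartite_digraph : digraph := Digraph Kab_arc_irr.

End CompleteBipartite.

(* Main.v *)
Require Import Defs.
From mathcomp Require Import all_boot all_fingroup.
From mathcomp Require Import zify.

(** When a digraph has exactly [2k] vertices, the sources and the sinks exhaust
    the vertex set, so each path of an unpaired cover is a single arc from its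
    source to its sink: a cover is the same thing as a perfect matching in the
    bipartite graph of arcs from [S] to [T] ([DDPC_iff_matching]).

    Both positive assertions then follow from an Ore-type condition
    ([matching_of_degree_sum]): a balanced bipartite graph with [k] vertices
    on each side has a perfect matching as soon as any two non-adjacent vertices
    on opposite sides have degrees adding up to at least [k].  For large minimum
    semi-degree, a source loses at most [k - 1] out-neighbours to the other
    sources, and likewise a sink, so every degree is at least half of [k].  In
    the complete bipartite digraph with [m] vertices on each side, let [a]
    sources lie on the left; then [a] sinks lie on the right, and non-adjacent
    endpoints lie on the same side, so that their degrees are [a] and [m - a].

    The bound on the semi-degree is sharp because it allows [a = uphalf k]
    sources to have only [a - 1] sinks as out-neighbours, against Hall's
    condition.

    A path of the complete bipartite digraph alternates between the two sides,
    so the sides of its ends determine its surplus of left vertices.  With all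
    sources and one sink on the left the total surplus of [k] paths is positive,
    whereas it is zero on the whole digraph; for [k < m] there is room for such
    a choice of endpoints. *)

Set Implicit Arguments.
Unset Strict Implicit.
Unset Printing Implicit Defensive.

(** * Matchings from degree sums *)

(** Take a permutation [sigma] using as many edges as possible, and suppose that
    [i] is not adjacent to [sigma i].  The sets of those [j] such that [i] is
    adjacent to [sigma j], and of those such that [j] is adjacent to [sigma i],
    both avoid [i] but have cardinals adding up to at least [#|T|], so they share
    some [j].  Exchanging the images of [i] and [j] then gains the edge at [i]
    without losing any. *)
Lemma matching_of_degree_sum (T : finType) (e : rel T) :
  (forall i j, ~~ e i j ->
     #|T| <= #|[set j' | e i j']| + #|[set i' | e i' j]|) ->
  exists sigma : {perm T}, forall i, e i (sigma i).
Proof.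
move=> ore.
pose good (sigma : {perm T}) := [set i | e i (sigma i)].
case: (@arg_maxnP _ (1%g : {perm T}) xpredT (fun sigma => #|good sigma|)) => //.
move=> sigma _ max_sigma; exists sigma => i; apply: contraT => not_e.
pose X := [set j | e i (sigma j)]; pose Y := [set j | e j (sigma i)].
have cardX : #|X| = #|[set j | e i j]|.
  rewrite -(card_imset X (@perm_inj _ sigma)); apply: eq_card => j.
  apply/imsetP/idP => [[j' + ->]|]; rewrite !inE // => eij.
  by exists (sigma^-1%g j); rewrite ?inE permKV.
have /card_gt0P[j] : 0 < #|X :&: Y|.
  have ore_i := ore _ _ not_e; rewrite -cardX -/Y in ore_i.
  have : #|X :|: Y| <= #|[set~ i]|.
    by apply/subset_leq_card/subsetP => j; rewrite !inE;
       case: eqP => // ->; rewrite (negbTE not_e).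
  have : 0 < #|T| by apply/card_gt0P; exists i.
  rewrite cardsC1; have := cardsUI X Y; lia.
rewrite !inE => /andP[eij eji].
pose tau := (tperm i j * sigma)%g.
suff /proper_card : good sigma \proper good tau.
  by rewrite ltnNge (max_sigma tau isT : #|good tau| <= #|good sigma|).
apply/properP; split; last by exists i; rewrite !inE ?permM ?tpermL.
apply/subsetP => l; rewrite !inE permM.
by case: tpermP => [-> /(negP not_e)|->|].
Qed.

(** * Endpoints exhausting the vertex set *)

Lemma card_endpoints (V : finType) (k : nat) (s t : 'I_k -> V) (Q : pred V) :
  #|V| = 2 * k -> injective s -> injective t -> (forall i j, s i != t j) ->
  #|[set v | Q v]| = #|[set i | Q (s i)]| + #|[set i | Q (t i)]|.
Proof.
move=> cardV s_inj t_inj st.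
pose f (u : 'I_k + 'I_k) := match u with inl i => s i | inr i => t i end.
have f_inj : injective f.
  move=> [i|i] [j|j] /=; try by move=> /s_inj -> || move=> /t_inj ->.
  - by move/eqP; rewrite (negbTE (st i j)).
  - by move/esym/eqP; rewrite (negbTE (st j i)).
have f_bij : bijective f.
  by apply: inj_card_bij f_inj _; rewrite card_sum card_ord cardV mul2n addnn.
rewrite -!sum1_card (reindex f) /=; last exact: onW_bij.
rewrite big_sumType /=; congr (_ + _); apply: eq_bigl => i;
  by rewrite !inE.
Qed.

Lemma endpoints_cover (V : finType) (k : nat) (s t : 'I_k -> V) :
  #|V| = 2 * k -> injective s -> injective t -> (forall i j, s i != t j) ->
  forall v, exists i, v = s i \/ v = t i.
Proof.
move=> cardV s_inj t_inj st v.
have := card_endpoints (pred1 v) cardV s_inj t_inj st.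
have -> : #|[set x | pred1 v x]| = 1.
  by rewrite -(cards1 v); apply: eq_card => x; rewrite !inE.
case: (set_0Vmem [set i | pred1 v (s i)]) => [->|[i]]; last first.
  by rewrite inE => /eqP <- _; exists i; left.
case: (set_0Vmem [set i | pred1 v (t i)]) => [->|[i]]; first by rewrite cards0.
by rewrite inE => /eqP <- _; exists i; right.
Qed.

(** All endpoints other than the two ends of a given path lie on the other,
    disjoint, paths; hence no vertex is left to be interior to it. *)
Lemma DDPC_iff_matching (D : digraph) (k : nat) (s t : 'I_k -> D) :
  #|D| = 2 * k -> injective s -> injective t -> (forall i j, s i != t j) ->
  (exists P, unpaired_DDPC s t P) <->
  (exists sigma : {perm 'I_k}, forall i, darc (s i) (t (sigma i))).
Proof.
move=> cardD s_inj t_inj st; have cover := endpoints_cover cardD s_inj t_inj st.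
split=> [[P [disjP _ [sigma pathP]]]|[sigma arcs]].
- have same i j v : v \in P i -> v \in P j -> i = j.
    move=> vi vj; apply/eqP; apply: contraT => /disjP /disjointFr /(_ vi).
    by rewrite vj.
  have srcP i : s i \in P i.
    move: (pathP i); case: (P i) => // z q /and4P[/eqP <- _ _ _].
    exact: mem_head.
  have snkP i : t (sigma i) \in P i.
    move: (pathP i); case: (P i) => // z q /and4P[_ _ /eqP <- _].
    exact: mem_last.
  exists sigma => i; move: (pathP i) (@same i).
  case: (P i) => // z [|w q] /and4P[/eqP ->].
    by move=> _ /= eq_st; rewrite (negbTE (st _ _)) in eq_st.
  move=> /andP[arc _] _ uniqP same_i.
  have w_in : w \in [:: s i, w & q] by rewrite !inE eqxx orbT.
  have [j [w_s|w_t]] := cover w.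
    have ij : i = j by apply: (same_i j w) => //; rewrite w_s.
    by move: uniqP; rewrite w_s -ij /= mem_head.
  have ij : i = sigma^-1%g j.
    by apply: (same_i _ w) => //; rewrite w_t -{1}(permKV sigma j).
  by rewrite ij permKV -w_t -ij.
- exists (fun i => [:: s i; t (sigma i)]); split.
  + move=> i j ij; rewrite disjoint_sym disjoint_has /= !inE.
    rewrite (inj_eq s_inj) (inj_eq t_inj) (inj_eq perm_inj).
    by rewrite [t _ == s _]eq_sym !(negbTE (st _ _)) orbF /= eq_sym (negbTE ij).
  + move=> v; have [i [->|->]] := cover v; first by exists i; rewrite mem_head.
    by exists (sigma^-1%g i); rewrite permKV !inE eqxx orbT.
  + by exists sigma => i; rewrite /dipath /= arcs !eqxx inE st.
Qed.

(** * Large minimum semi-degree *)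

Lemma leq_min_semidegree (D : digraph) (d : nat) :
  (d <= min_semidegree D) =
  (d <= #|D|) && [forall v : D, (d <= outdeg v) && (d <= indeg v)].
Proof.
have -> : [forall v : D, (d <= outdeg v) && (d <= indeg v)] =
          all (fun v : D => (d <= outdeg v) && (d <= indeg v)) (index_enum D).
  by apply/forallP/allP => [H v _|H v]; [exact: H | apply: H; rewrite mem_index_enum].
rewrite /min_semidegree; elim: (index_enum D) => [|v r IHr].
  by rewrite big_nil andbT.
by rewrite big_cons /= !leq_min IHr andbCA.
Qed.

Lemma coverable_of_min_semidegree (k : nat) (D : digraph) :
  #|D| = 2 * k -> uphalf (#|D| + k) - 1 <= min_semidegree D ->
  unpaired_coverable D k.
Proof.
move=> cardD; rewrite leq_min_semidegree => /andP[_ /forallP deg].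
split=> [|s t s_inj t_inj st]; first by rewrite cardD.
apply/DDPC_iff_matching => //.
apply: (@matching_of_degree_sum 'I_k (fun i j => darc (s i) (t j))) => i j _; rewrite card_ord.
have /andP[deg_s _] := deg (s i); have /andP[_ deg_t] := deg (t j).
rewrite /outdeg (card_endpoints _ cardD s_inj t_inj st) in deg_s.
rewrite /indeg (card_endpoints _ cardD s_inj t_inj st) in deg_t.
have ss : #|[set i' | darc (s i) (s i')]| <= k.-1.
  have -> : k.-1 = #|[set~ i]| by rewrite cardsC1 card_ord.
  apply/subset_leq_card/subsetP => i'.
  by rewrite !inE; case: eqP => // ->; rewrite darc_irr.
have tt : #|[set j' | darc (t j') (t j)]| <= k.-1.
  have -> : k.-1 = #|[set~ j]| by rewrite cardsC1 card_ord.
  apply/subset_leq_card/subsetP => j'.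
  by rewrite !inE; case: eqP => // ->; rewrite darc_irr.
move: ss tt deg_s deg_t; rewrite cardD.
by move: #|_| #|_| #|_| #|_| => a b c d; lia.
Qed.

(** * Sharpness of the semi-degree bound *)

Lemma card_ord_lt (a k : nat) : a <= k -> #|[set i : 'I_k | i < a]| = a.
Proof.
move=> le_ak; rewrite -sum1_card (eq_bigl (fun i : 'I_k => i < a)).
  by rewrite -(big_ord_widen k (fun=> 1)) // sum1_card card_ord.
by move=> i; rewrite inE.
Qed.

Section Deficient.
Variable k : nat.

(** Hall's condition fails for the first [uphalf k] sources, which see only the
    first [uphalf k - 1] sinks; all other arcs are kept, so that the degrees are
    as large as this obstruction allows. *)
Definition deficient_arc : rel ('I_k + 'I_k)%type := fun u v =>
  (u != v) && match u, v with
              | inl i, inr j => ~~ ((i < uphalf k) && ((uphalf k).-1 <= j))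
              | _, _ => true
              end.

Lemma deficient_arc_irr : irreflexive deficient_arc.
Proof. by move=> u; rewrite /deficient_arc eqxx. Qed.

Definition deficient_digraph : digraph := Digraph deficient_arc_irr.

Lemma card_deficient : #|deficient_digraph| = 2 * k.
Proof. by rewrite card_sum card_ord mul2n addnn. Qed.

Lemma card_deficient_set (Q : pred ('I_k + 'I_k)%type) :
  #|[set v | Q v]| = #|[set i | Q (inl i)]| + #|[set i | Q (inr i)]|.
Proof.
apply: card_endpoints => //; first exact: card_deficient.
- by move=> i j [].
- by move=> i j [].
Qed.

Lemma deficient_min_semidegree :
  2 <= k -> min_semidegree deficient_digraph = uphalf (2 * k + k) - 2.
Proof.
move=> k_ge2.
have C1 (i : 'I_k) : #|[set j | j != i]| = k.-1.
  have -> : k.-1 = #|[set~ i]| by rewrite cardsC1 card_ord.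
  by apply: eq_card => j; rewrite !inE.
have CT : #|[set _ : 'I_k | true]| = k.
  by rewrite -[RHS]card_ord; apply: eq_card => j; rewrite !inE.
have outl (i : 'I_k) : outdeg (inl i : deficient_digraph) =
    k.-1 + (if i < uphalf k then (uphalf k).-1 else k).
  rewrite /outdeg card_deficient_set; congr (_ + _).
    by rewrite -(C1 i); apply: eq_card => j;
      rewrite !inE /= /deficient_arc andbT eq_sym.
  case: ifP => lt_i.
    rewrite -[RHS](@card_ord_lt _ k); last lia.
    by apply: eq_card => j; rewrite !inE /= /deficient_arc lt_i /= -ltnNge.
  by rewrite -[RHS]CT; apply: eq_card => j; rewrite !inE /= /deficient_arc lt_i.
have outr (j : 'I_k) : outdeg (inr j : deficient_digraph) = k + k.-1.
  rewrite /outdeg card_deficient_set; congr (_ + _).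
    by rewrite -[RHS]CT; apply: eq_card => i; rewrite !inE.
  by rewrite -(C1 j); apply: eq_card => i;
    rewrite !inE /= /deficient_arc andbT eq_sym.
have indegl (i : 'I_k) : indeg (inl i : deficient_digraph) = k.-1 + k.
  rewrite /indeg card_deficient_set; congr (_ + _).
    by rewrite -(C1 i); apply: eq_card => j; rewrite !inE /= /deficient_arc andbT.
  by rewrite -[RHS]CT; apply: eq_card => j; rewrite !inE.
have indegr (j : 'I_k) : k - uphalf k + k.-1 <= indeg (inr j : deficient_digraph).
  rewrite /indeg card_deficient_set; apply: leq_add; last first.
    rewrite -(C1 j); apply/eq_leq/eq_card => i.
    by rewrite !inE /= /deficient_arc andbT.
  have -> : k - uphalf k = #|~: [set i : 'I_k | i < uphalf k]|.
    by rewrite cardsCs setCK card_ord card_ord_lt //; lia.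
  apply/subset_leq_card/subsetP => i; rewrite !inE /= /deficient_arc /=.
  by move=> /negbTE ->.
apply/eqP; rewrite eqn_leq; apply/andP; split.
  have k_gt0 : 0 < k by lia.
  have := leqnn (min_semidegree deficient_digraph); rewrite leq_min_semidegree.
  case/andP=> _ /forallP /(_ (inl (Ordinal k_gt0))) /andP[+ _].
  by rewrite outl /= ifT; lia.
rewrite leq_min_semidegree card_deficient; apply/andP; split; first lia.
apply/forallP => -[i|j]; apply/andP; split.
- by rewrite outl; case: ifP => _; lia.
- rewrite indegl; lia.
- rewrite outr; lia.
- by apply: leq_trans (indegr j); lia.
Qed.

Lemma deficient_not_coverable : 2 <= k -> ~ unpaired_coverable deficient_digraph k.
Proof.
move=> k_ge2 [_ cov].
have inlI : injective (inl : 'I_k -> deficient_digraph) by move=> i j [].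
have inrI : injective (inr : 'I_k -> deficient_digraph) by move=> i j [].
have lr (i j : 'I_k) : (inl i : deficient_digraph) != inr j by [].
case/(DDPC_iff_matching card_deficient inlI inrI lr): (cov _ _ inlI inrI lr).
move=> sigma arcs.
have : #|[set sigma i | i in [set i : 'I_k | i < uphalf k]]|
       <= #|[set j : 'I_k | j < (uphalf k).-1]|.
  apply/subset_leq_card/subsetP => _ /imsetP[i + ->]; rewrite !inE => lt_i.
  by have := arcs i; rewrite /= /deficient_arc /= lt_i /= -ltnNge.
rewrite card_imset ?card_ord_lt; [lia | lia | lia | exact: perm_inj].
Qed.

End Deficient.

(** * Complete bipartite digraphs *)

Section CompleteBipartite.
Variable m : nat.
Let K := complete_bipartite_digraph m m.
Definition on_left (v : K) : bool := is_inl v.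

Lemma Kab_arcE (u v : K) : darc u v = (on_left u != on_left v).
Proof. by case: u v => [i|i] [j|j]. Qed.

Lemma card_bipartite : #|K| = 2 * m.
Proof. by rewrite card_sum !card_ord mul2n addnn. Qed.

Lemma card_side (b : bool) : #|[set v | on_left v == b]| = m.
Proof.
rewrite (@card_endpoints K m inl inr) //; last 3 first.
- exact: card_bipartite.
- by move=> i j [].
- by move=> i j [].
rewrite -[RHS]card_ord -cardsT.
by case: b; [rewrite -[RHS]addn0 | rewrite -[RHS]add0n]; congr (_ + _);
  rewrite -?(cards0 'I_m); apply: eq_card => i; rewrite !inE.
Qed.

Lemma bipartite_coverable : unpaired_coverable K m.
Proof.
split=> [|s t s_inj t_inj st]; first by rewrite card_bipartite.
apply/(DDPC_iff_matching card_bipartite s_inj t_inj st).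
apply: (@matching_of_degree_sum 'I_m (fun i j => darc (s i) (t j))) => i j.
rewrite Kab_arcE negbK => /eqP same_side.
(* The neighbours of [s i] and of [t j] are the endpoints on one and the same
   side, the one opposite to both, which has [m] vertices. *)
rewrite card_ord -[X in X <= _](card_side (~~ on_left (s i))).
rewrite (card_endpoints _ card_bipartite s_inj t_inj st) addnC.
apply/eq_leq; congr (_ + _); apply: eq_card => l; rewrite !inE Kab_arcE.
  by case: (on_left _); case: (on_left _).
by rewrite same_side; case: (on_left _); case: (on_left _).
Qed.

Lemma alternating_count (z : K) (q : seq K) : path (@darc K) z q ->
  (count on_left (z :: q)).+1 =
  count (predC on_left) (z :: q) + on_left z + on_left (last z q).
Proof.
elim: q z => [|w q IHq] z /= => [_|/andP[]]; first by case: (on_left z).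
rewrite -[Kab_arc z w]/(@darc K z w) Kab_arcE => zw /IHq /=.
by case: (on_left z) zw; case: (on_left w) => //= _; lia.
Qed.

End CompleteBipartite.

Lemma sum_count_DDPC (D : digraph) (k : nat) (s t : 'I_k -> D)
    (P : 'I_k -> seq D) (Q : pred D) :
  unpaired_DDPC s t P -> \sum_i count Q (P i) = #|[set v | Q v]|.
Proof.
case=> disjP coverP [sigma pathP].
have uniqP i : uniq (P i).
  by move: (pathP i); rewrite /dipath; case: (P i) => // z q /and4P[].
under eq_bigr => i _ do
  rewrite -sum1_count big_mkcond big_uniq ?uniqP //= -big_mkcondr /=.
rewrite (exchange_big_dep Q) => [|i v _ /andP[]//] /=.
rewrite -sum1_card; apply: eq_big => [v|v Qv]; first by rewrite inE.
have [i vi] := coverP v; rewrite (big_pred1 i) // => j.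
rewrite Qv andbT; apply/idP/eqP => [vj|->//].
by apply/eqP; apply: contraT => /disjP /disjointFr /(_ vj); rewrite vi.
Qed.

Lemma bipartite_not_coverable (m k : nat) : 1 <= k -> k < m ->
  ~ unpaired_coverable (complete_bipartite_digraph m m) k.
Proof.
move=> k_gt0 lt_km [_ cov]; set K := complete_bipartite_digraph m m in cov.
have w (i : 'I_k) : i < m by apply: ltn_trans lt_km.
pose s (i : 'I_k) : K := inl (Ordinal (w i)).
(* Position [k] on the left is free, as the sources occupy those below [k]. *)
pose t (i : 'I_k) : K :=
  if i == 0 :> nat then inl (Ordinal lt_km) else inr (Ordinal (w i)).
have s_inj : injective s by move=> i j [] ij; exact: val_inj.
have t_inj : injective t.
  move=> i j; rewrite /t; case: eqP => i0; case: eqP => j0 //.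
    by move=> _; apply: val_inj; rewrite /= i0 j0.
  by case=> ij; exact: val_inj.
have st i j : s i != t j.
  rewrite /s /t; case: ifP => // _; apply/eqP => -[] ik.
  by have := ltn_ord i; rewrite ik ltnn.
have [P ddpc] := cov s t s_inj t_inj st.
have countL := sum_count_DDPC (@on_left m) ddpc.
have countR := sum_count_DDPC (predC (@on_left m)) ddpc.
have [_ _ [sigma pathP]] := ddpc.
have surplus i : count (@on_left m) (P i) =
    count (predC (@on_left m)) (P i) + on_left (t (sigma i)).
  move: (pathP i); rewrite /dipath; case: (P i) => // z q.
  case/and4P=> /eqP z_s /alternating_count alt /eqP last_t _.
  by move: alt; rewrite last_t z_s /=; lia.
have total : \sum_i count (@on_left m) (P i) =
    \sum_i count (predC (@on_left m)) (P i).
  rewrite countL countR; transitivity m.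
    by rewrite -[RHS](card_side m true); apply: eq_card => v; rewrite !inE eqb_id.
  by rewrite -[LHS](card_side m false); apply: eq_card => v; rewrite !inE eqbF_neg.
have : 0 < \sum_i on_left (t (sigma i)).
  by rewrite (bigD1 (sigma^-1%g (Ordinal k_gt0))) //= permKV.
move: total; rewrite (eq_bigr _ (fun i _ => surplus i)) big_split /=.
by move/eqP; rewrite -[X in _ == X]addn0 eqn_add2l => /eqP ->.
Qed.

Theorem theorem2 :
  ((forall (k : nat) (D : digraph), 0 < k -> #|D| = 2 * k ->
      uphalf (#|D| + k) - 1 <= min_semidegree D ->
      unpaired_coverable D k)
   /\
   (forall k n : nat, 2 <= k -> n = 2 * k ->
      exists D : digraph,
        [/\ #|D| = n,
            min_semidegree D = uphalf (n + k) - 2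
          & ~ unpaired_coverable D k]))
  /\
  (forall m : nat, 2 <= m ->
     unpaired_coverable (complete_bipartite_digraph m m) m /\
     (forall k : nat, 1 <= k -> k < m ->
        ~ unpaired_coverable (complete_bipartite_digraph m m) k)).
Proof.
split; [split|].
- by move=> k D _; exact: coverable_of_min_semidegree.
- move=> k n k_ge2 ->; exists (deficient_digraph k); split.
  + exact: card_deficient.
  + exact: deficient_min_semidegree.
  + exact: deficient_not_coverable.
- move=> m _; split; first exact: bipartite_coverable.
  exact: bipartite_not_coverable.
Qed.
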